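(* Let $p\neq\ell$ be primes, $d\ge1$ an integer, $\Gamma=\mathbb{Z}_p^d$ and $\Gamma_n=\Gamma/\Gamma^{p^n}$. Let $F=\sum_{i=1}^kb_iT_1^{a_{i,1}}\cdots T_d^{a_{i,d}}\in\Phi_{p,d}$ be a non-zero element, where the exponent vectors $(a_{i,1},\dots,a_{i,d})\in\mathbb{Z}_p^d$ are pairwise distinct and $b_i\in\mathbb{Z}$. Then $$\sum_{\omega\in\mathrm{Supp}_n(F)}\mathrm{ord}_\ell(\omega(F))=p^{nd}\mu_\ell(F)+O(p^{(d-1)n})$$ as $n\to\infty$, where $\mu_\ell(F)=\min(\mathrm{ord}_\ell(b_i):1\le i\le k)$.
   Context: $\Phi_{p,d}=\mathbb{Z}[T_1,\dots,T_d;\mathbb{Z}_p]$ is the ring of finite $\mathbb{Z}$-linear combinations of monomials $T_1^{a_1}\cdots T_d^{a_d}$ with $a_i\in\mathbb{Z}_p$, i.e. the group ring $\mathbb{Z}[\mathbb{Z}_p^d]$. The group $\Gamma=\mathbb{Z}_p^d$ is written multiplicatively, with standard topological generators $\gamma_1,\dots,\gamma_d$. $\Gamma_n^\vee$ is the set of characters $\Gamma_n\to\overline{\mathbb{Q}}_\ell^\times$, regarded as characters of $\Gamma$. For $\omega\in\Gamma_n^\vee$, $\omega(F)\in\overline{\mathbb{Q}}_\ell$ is obtained by the substitution $T_1^{a_1}\cdots T_d^{a_d}\mapsto\omega(\gamma_1)^{a_1}\cdots\omega(\gamma_d)^{a_d}$ ($p$-power roots of unity may be raised to powers in $\mathbb{Z}_p$).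 $\mathrm{Supp}_n(F)=\{\omega\in\Gamma_n^\vee:\omega(F)\ne0\}$. $\mathrm{ord}_\ell$ is the valuation on $\overline{\mathbb{Q}}_\ell$ with $\mathrm{ord}_\ell(\ell)=1$. The implied constant does not depend on $n$. *)

(* Defs.v *)
From HB Require Import structures.
From mathcomp Require Import all_boot all_order all_algebra.
From mathcomp Require Import boolp classical_sets functions cardinality fsbigop.
From mathcomp Require Import filter reals ereal.
From mathcomp Require Export freeg.

Set Implicit Arguments.
Unset Strict Implicit.
Unset Printing Implicit Defensive.

Import Order.TTheory GRing.Theory Num.Theory.

Local Open Scope ring_scope.

(* The ring of p-adic integers, as the inverse limit of the rings Z/p^n:      *)
(* [zp_res x n] is the residue of [x] modulo p ^ n, in [0, p ^ n).            *)
Record padic_int (p : nat) (p_pr : prime p) := PadicInt {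
  zp_res : nat -> nat;
  zp_resP : forall n, (zp_res n = zp_res n.+1 %% p ^ n)%N
}.

Section PadicInt.
Variables (p : nat) (p_pr : prime p).
Local Notation Zp := (padic_int p_pr).

HB.instance Definition _ := gen_eqMixin Zp.
HB.instance Definition _ := gen_choiceMixin Zp.

Lemma zp_ext (x y : Zp) : zp_res x =1 zp_res y -> x = y.
Proof.
case: x y => [x xP] [y yP] /= /funext exy; case: _ / exy in yP *.
by congr PadicInt; exact: Prop_irrelevance.
Qed.

Lemma zp_pow_gt0 n : (0 < p ^ n)%N.
Proof. by rewrite expn_gt0 prime_gt0. Qed.

Lemma zp_resm (x : Zp) n : (zp_res x n %% p ^ n = zp_res x n)%N.
Proof. by rewrite zp_resP modn_mod. Qed.

Lemma zp_of_subproof (u : nat -> nat) :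
  (forall n, u n.+1 = u n %[mod p ^ n])%N ->
  forall n, (u n %% p ^ n = (u n.+1 %% p ^ n.+1) %% p ^ n)%N.
Proof. by move=> uP n; rewrite modn_dvdm ?dvdn_exp2l// uP. Qed.

Definition zp_of (u : nat -> nat) uP : Zp :=
  PadicInt p_pr (@zp_of_subproof u uP).

Lemma zp_resS (x : Zp) n : (zp_res x n.+1 = zp_res x n %[mod p ^ n])%N.
Proof. by rewrite -zp_resP zp_resm. Qed.

Lemma zp_const_subproof (k n : nat) : (k = k %[mod p ^ n])%N.
Proof. by []. Qed.

Lemma zp_add_subproof (x y : Zp) n :
  (zp_res x n.+1 + zp_res y n.+1 = zp_res x n + zp_res y n %[mod p ^ n])%N.
Proof. by rewrite -modnDm !zp_resS modnDm. Qed.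

Lemma zp_mul_subproof (x y : Zp) n :
  (zp_res x n.+1 * zp_res y n.+1 = zp_res x n * zp_res y n %[mod p ^ n])%N.
Proof. by rewrite -modnMm !zp_resS modnMm. Qed.

Lemma zp_opp_subproof (x : Zp) n :
  (p ^ n.+1 - zp_res x n.+1 = p ^ n - zp_res x n %[mod p ^ n])%N.
Proof.
have le m : (zp_res x m <= p ^ m)%N.
  by rewrite -zp_resm ltnW// ltn_mod zp_pow_gt0.
apply/eqP; rewrite -(eqn_modDr (zp_res x n.+1)) subnK ?le//.
by rewrite -modnDmr zp_resS modnDmr subnK ?le// expnS modnMl modnn.
Qed.

Definition zp_add x y := zp_of (zp_add_subproof x y).
Definition zp_mul x y := zp_of (zp_mul_subproof x y).
Definition zp_opp x := zp_of (zp_opp_subproof x).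
Definition zp_const k := zp_of (zp_const_subproof k).

Lemma zp_addA : associative zp_add.
Proof. by move=> x y z; apply: zp_ext => n /=; rewrite modnDmr modnDml addnA. Qed.
Lemma zp_addC : commutative zp_add.
Proof. by move=> x y; apply: zp_ext => n /=; rewrite addnC. Qed.
Lemma zp_add0 : left_id (zp_const 0) zp_add.
Proof. by move=> x; apply: zp_ext => n /=; rewrite mod0n add0n zp_resm. Qed.
Lemma zp_addN : left_inverse (zp_const 0) zp_opp zp_add.
Proof.
move=> x; apply: zp_ext => n /=; rewrite modnDml subnK ?modnn ?mod0n//.
by rewrite -zp_resm ltnW// ltn_mod zp_pow_gt0.
Qed.
HB.instance Definition _ :=
  GRing.isZmodule.Build Zp zp_addA zp_addC zp_add0 zp_addN.

Lemma zp_mulA : associative zp_mul.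
Proof. by move=> x y z; apply: zp_ext => n /=; rewrite modnMmr modnMml mulnA. Qed.
Lemma zp_mulC : commutative zp_mul.
Proof. by move=> x y; apply: zp_ext => n /=; rewrite mulnC. Qed.
Lemma zp_mul1 : left_id (zp_const 1) zp_mul.
Proof. by move=> x; apply: zp_ext => n /=; rewrite modnMml mul1n zp_resm. Qed.
Lemma zp_mulD : left_distributive zp_mul zp_add.
Proof.
by move=> x y z; apply: zp_ext => n /=; rewrite modnMml modnDm mulnDl.
Qed.
Lemma zp_one_neq0 : zp_const 1 != 0.
Proof.
apply/eqP => /(congr1 (fun x => zp_res x 1)) /=.
by rewrite expn1 modn_small ?prime_gt1// mod0n.
Qed.
HB.instance Definition _ := GRing.Zmodule_isComNzRing.Build Zp
  zp_mulA zp_mulC zp_mul1 zp_mulD zp_one_neq0.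

Definition zp_unit : {pred Zp} := fun x => `[< exists y : Zp, y * x = 1 >].
Definition zp_inv (x : Zp) : Zp :=
  if pselect (exists y : Zp, y * x = 1) is left h then sval (cid h) else x.

Lemma zp_mulVx : {in zp_unit, left_inverse 1 zp_inv *%R}.
Proof.
move=> x /asboolP ux; rewrite /zp_inv; case: pselect => // h.
by case: (cid h).
Qed.
Lemma zp_unitPl (x y : Zp) : y * x = 1 -> zp_unit x.
Proof. by move=> yx; apply/asboolP; exists y. Qed.
Lemma zp_invr_out : {in [predC zp_unit], zp_inv =1 id}.
Proof.
by move=> x /asboolPn ux; rewrite /zp_inv; case: pselect.
Qed.
HB.instance Definition _ := GRing.ComNzRing_hasMulInverse.Build Zp
  zp_mulVx zp_unitPl zp_invr_out.

Lemma zp_res_modn (x : Zp) m n : (m <= n)%N ->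
  (zp_res x n = zp_res x m %[mod p ^ m])%N.
Proof.
move=> /subnK <-; elim: (n - m)%N => [//|k IH].
rewrite addSn -IH -[in LHS](@modn_dvdm (p ^ (k + m))) ?dvdn_exp2l ?leq_addl//.
by rewrite zp_resS modn_dvdm// dvdn_exp2l// leq_addl.
Qed.

Lemma zp_neq0P (x : Zp) : x != 0 -> exists n, zp_res x n != 0%N.
Proof.
move=> x0; apply: contrapT => /forallNP h; case/eqP: x0; apply: zp_ext => n /=.
by rewrite mod0n; apply/eqP/negPn/negP => /h.
Qed.

Lemma zp_logn (x : Zp) m n : zp_res x m != 0%N -> (m <= n)%N ->
  (0 < zp_res x n)%N /\ (logn p (zp_res x n) < m)%N.
Proof.
move=> xm mn.
have ndv : ~~ (p ^ m %| zp_res x n)%N.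
  by rewrite /dvdn (zp_res_modn x mn) zp_resm.
have xn : (0 < zp_res x n)%N.
  by rewrite lt0n; apply: contraNneq ndv => ->; rewrite dvdn0.
by split => //; move: ndv; rewrite pfactor_dvdn// -ltnNge.
Qed.

Lemma zp_integral (x y : Zp) : x * y = 0 -> (x == 0) || (y == 0).
Proof.
move=> xy0; apply/norP => -[/zp_neq0P[m xm] /zp_neq0P[k yk]].
have [x0 xlt] := zp_logn xm (leq_addr k m).
have [y0 ylt] := zp_logn yk (leq_addl m k).
have /(congr1 (fun z => zp_res z (m + k))) /= := xy0.
rewrite mod0n => /eqP; apply/negP; rewrite -/(dvdn _ _).
rewrite pfactor_dvdn ?muln_gt0 ?x0// lognM// -ltnNge.
by apply: leq_trans (leq_add xlt (ltnW ylt)); rewrite addSn.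
Qed.
HB.instance Definition _ := GRing.ComUnitRing_isIntegral.Build Zp zp_integral.

End PadicInt.

Definition padic_field (p : nat) (p_pr : prime p) : fieldType :=
  {fraction (padic_int p_pr)}.

(* [L] is algebraically closed by its type.                                   *)
Definition alg_closure_of (F : fieldType) (L : closedFieldType)
    (iota : {rmorphism F -> L}) : Prop :=
  forall x : L, algebraicOver iota x.

(* The l-adic valuation on an extension [L] of [Q_l] (with ord 0 = +oo).  The *)
(* last two conditions say that it extends the l-adic valuation of [Q_l],     *)
(* as every non-zero element of [Z_l] is l ^ m times a unit.  Without the     *)
(* condition on [Z_l] there would be further valuations on an algebraic       *)
(* closure of [Q_l] with ord l = 1.                                           *)
Definition is_ladic_ord (l : nat) (l_pr : prime l) (L : fieldType)
    (iota : {rmorphism padic_field l_pr -> L}) (ord : L -> \bar rat) : Prop :=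
  [/\ forall x, ord x = +oo%E <-> x = 0,
      forall x y, ord (x * y) = (ord x + ord y)%E,
      forall x y, (Order.min (ord x) (ord y) <= ord (x + y)%R)%E,
      forall x : padic_int l_pr, (0 <= ord (iota (FracField.tofrac x)))%E
    & ord l%:R = 1%:E].

(* The group Gamma = Z_p^d, written additively.                               *)
Definition Gam (p : nat) (p_pr : prime p) (d : nat) := 'rV[padic_int p_pr]_d.

Definition gam (p : nat) (p_pr : prime p) (d : nat) (i : 'I_d) : Gam p_pr d :=
  delta_mx 0 i.

(* The group ring Z[Z_p^d], with its additive structure only: the monomial    *)
(* T^a is <<a>>, and [dom] and [coeff] give the exponents and coefficients.   *)
Definition Phi (p : nat) (p_pr : prime p) (d : nat) :=
  {freeg (Gam p_pr d) / int}.

Section Characters.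
Variables (p : nat) (p_pr : prime p) (d : nat) (L : fieldType).
Implicit Types (w : Gam p_pr d -> L) (F : Phi p_pr d).

(* The characters of Gamma that are trivial on the subgroup p ^ n Gamma.      *)
Definition Gam_dual (n : nat) : set (Gam p_pr d -> L) :=
  [set w | [/\ w 0 = 1, (forall x y, w (x + y) = w x * w y)
             & (forall x, w (x *+ p ^ n) = 1)]]%classic.

(* The p-adic power z ^ a, for z such that z ^ (p ^ n) = 1.                   *)
Definition zp_exp (n : nat) (z : L) (a : padic_int p_pr) : L :=
  z ^+ zp_res a n.

(* omega(F), for omega in [Gam_dual n].                                       *)
Definition char_eval (n : nat) w F : L :=
  \sum_(a <- dom F)
    (coeff a F)%:~R * \prod_(i < d) zp_exp n (w (gam p_pr i)) (a 0 i).

Definition Supp (n : nat) F : set (Gam p_pr d -> L) :=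
  [set w | Gam_dual n w /\ char_eval n w F != 0]%classic.

End Characters.

(* Main.v *)
Require Import Defs.
From HB Require Import structures.
From mathcomp Require Import all_boot all_order all_algebra cyclic separable
  cyclotomic.
From mathcomp Require Import boolp classical_sets functions cardinality fsbigop.
From mathcomp Require Import filter reals ereal ring.

Set Implicit Arguments.
Unset Strict Implicit.
Unset Printing Implicit Defensive.

Import Order.TTheory GRing.Theory Num.Theory.

Local Open Scope ring_scope.

(* An integer combination S of p-power roots of unity z_i, with integer       *)
(* coefficients b_i, can be projected: l is unramified in Q(mu_(p^n)), so the *)
(* Frobenius z |-> z^l preserves the condition ord S > c (c a natural number).*)
(* For a suitable m (depending on p and l only) and every s >= m, some power  *)
(* of l generates Gal(Q(mu_(p^(s+1))) / Q(mu_(p^s))), and averaging over that *)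
(* group, whose order p is an l-adic unit, kills the z_i outside mu_(p^s).    *)
(* After a twist by z_j^-1 this shows that ord S > c implies ord S_j > c,     *)
(* where S_j is the partial sum over the i with z_i / z_j in mu_(p^m).        *)
(* Taking z_i = w(a_i), two things follow.  If w(a_i - a_j) is in mu_(p^m)    *)
(* for no pair i <> j, then S_j is b_j z_j and ord w(F) = mu; the other w     *)
(* are O(p^((d-1)n)) in number.  For these, if w(F) <> 0 then some S_j <> 0,  *)
(* and up to a root of unity S_j takes finitely many values, so ord w(F) is   *)
(* bounded independently of w and n.                                          *)

(** [ord_frobenius] and [ord_project_class] pass a lower bound on the order of a full sum to its
    partial sums over classes modulo mu_(p^m), with m from [expn_levels]. Galois theory enters only
    through congruences modulo l between integer polynomials evaluated at roots of unity.
    [ord_sum_separated] then gives the exact value mu at characters that separate the exponents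
    modulo mu_(p^m), and [ord_sum_bounded] a uniform bound at the others. By [card_char_of_torsion]
    the latter are few: w(x)^(p^m) = 1 with x non-zero is a linear congruence on the exponents of w,
    which saves a factor p^n up to a constant. So all but O(p^((d-1)n)) of the p^(nd) characters
    contribute exactly mu, and each exception deviates by a bounded amount. *)

Lemma exprD_prime (R : comNzRingType) (l : nat) (x y : R) : prime l ->
  exists r, (x + y) ^+ l = x ^+ l + y ^+ l + l%:R * r.
Proof.
move=> l_pr; case: l l_pr => [//|[//|n]] l_pr.
exists (\sum_(i < n.+1) (x ^+ (n.+1 - i) * y ^+ i.+1)
          *+ ('C(n.+2, i.+1) %/ n.+2)).
rewrite exprDn big_ord_recl big_ord_recr /= bin0 binn !mulr1n subn0 expr0 mulr1.
rewrite /bump /= add1n subnn expr0 mul1r -addrA; congr (_ + _).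
rewrite addrC; congr (_ + _); rewrite mulr_sumr; apply: eq_bigr => i _.
rewrite /bump /= add1n subSS mulr_natl -mulrnA divnK //.
by apply: prime_dvd_bin => //=; exact: ltn_ord i.
Qed.

(** For r = 1, the polynomials satisfying the congruence are closed under sums and products and
    include the constants and X. The general case iterates this one. *)
Lemma frobenius_polyZ (l r : nat) (f : {poly int}) : prime l ->
  exists g, f ^+ (l ^ r) = f \Po 'X^(l ^ r) + l%:R * g.
Proof.
move=> l_pr.
pose P (f : {poly int}) := exists g, f ^+ l = f \Po 'X^l + l%:R * g.
have PD f1 f2 : P f1 -> P f2 -> P (f1 + f2).
  case=> g1 E1 [g2 E2]; rewrite /P; have [h ->] := exprD_prime f1 f2 l_pr.
  by exists (g1 + g2 + h); rewrite E1 E2 rmorphD /=; ring.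
have PM f1 f2 : P f1 -> P f2 -> P (f1 * f2).
  case=> g1 E1 [g2 E2]; exists (g1 * (f2 \Po 'X^l) + f1 ^+ l * g2).
  by rewrite exprMn E2 mulrDr E1 rmorphM /=; ring.
have P1 : P 1 by exists 0; rewrite expr1n rmorph1 mulr0 addr0.
have P0 : P 0.
  by exists 0; rewrite expr0n rmorph0 mulr0 addr0 gtn_eqF ?prime_gt0.
have PN1 : P (-1).
  have [h] := exprD_prime 1 (-1 : {poly int}) l_pr.
  rewrite subrr expr0n gtn_eqF ?prime_gt0//= expr1n => h0.
  exists (- h); rewrite rmorphN1; set u := (-1) ^+ l in h0 *.
  have -> : u = 1 + u + l%:R * h - 1 - l%:R * h by ring.
  by rewrite -h0; ring.
have Pn (n : nat) : P n%:R.
  by elim: n => [//|n IH]; rewrite -natr1; apply: PD.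
have PC (c : int) : P c%:P.
  case: c => n; first by rewrite -[Posz n]natz polyC_natr.
  by rewrite NegzE polyCN -natz polyC_natr -mulN1r; apply: PM.
have Pall g : P g.
  elim/poly_ind: g => [//|g c IH]; apply: PD => //; apply: PM => //.
  by exists 0; rewrite comp_polyX mulr0 addr0.
elim: r f => [|r IH] f.
  by exists 0; rewrite expn0 expr1 comp_polyXr mulr0 addr0.
rewrite expnSr exprM; have [g ->] := IH f.
have [h ->] := exprD_prime (f \Po 'X^(l ^ r)) (l%:R * g) l_pr.
have [g' ->] := Pall (f \Po 'X^(l ^ r)).
exists (g' + l%:R ^+ l.-1 * g ^+ l + h).
rewrite -comp_polyA comp_Xn_poly -exprM [(l * l ^ r)%N]mulnC exprMn.
have -> : l%:R ^+ l = l%:R * l%:R ^+ l.-1 :> {poly int}.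
  by rewrite -exprS prednK ?prime_gt0.
by ring.
Qed.

(** * Roots of unity and powers of l modulo powers of p *)

Lemma closed_prim_root (K : closedFieldType) (N : nat) :
  N%:R != 0 :> K -> exists z : K, N.-primitive_root z.
Proof.
move=> N0; have N_gt0 : (0 < N)%N by rewrite lt0n; apply: contraNneq N0 => ->.
pose f : {poly K} := 'X^N - 1; have [r Df] := closed_field_poly_normal f.
rewrite (monicP _) ?monicXnsubC // scale1r in Df.
have rN1 : all N.-unity_root r by apply/allP => z; rewrite -root_prod_XsubC -Df.
have sz_r : (N < (size r).+1)%N.
  by rewrite -(size_prod_XsubC r id) -Df size_XnsubC.
have [|z] := hasP (has_prim_root N_gt0 rN1 _ sz_r); last by exists z.
by rewrite -separable_prod_XsubC -Df separable_Xn_sub_1.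
Qed.

Lemma unity_root_powX_coprime (R : comNzRingType) (w : R) (m u : nat) :
  w ^+ m = 1 -> coprime u m -> w ^+ u = 1 -> w = 1.
Proof.
move=> wm um wu.
have [m1|m1] := leqP m 1.
  case: m m1 wm um => [|[|//]] _; last by rewrite expr1.
  by rewrite /coprime gcdn0 => _ /eqP u1; rewrite u1 expr1 in wu.
rewrite -[LHS]expr1 -[1%N](modn_small m1) -(Euler_exp_totient um) expr_mod//.
by rewrite -[totient m]prednK ?totient_gt0 ?(ltnW m1)// expnS exprM wu expr1n.
Qed.

(** The powers of Q run over Gal(Q(mu_(p^(s+1))) / Q(mu_(p^s))), so this is a trace. With Q = p^s u
    + 1 and u prime to p, z^(Q^t) = z xi^t for the p-th root of unity xi = z^(p^s u), and the sum is
    geometric; xi = 1 exactly when z^(p^s) = 1. *)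
Lemma sum_unity_root_conj (K : fieldType) (p s Q : nat) (z : K) : prime p ->
  (0 < s)%N -> (Q = 1 %[mod p ^ s])%N -> (Q != 1 %[mod p ^ s.+1])%N ->
  z ^+ (p ^ s.+1) = 1 ->
  \sum_(t < p) z ^+ (Q ^ t) = if z ^+ (p ^ s) == 1 then p%:R * z else 0.
Proof.
move=> p_pr s0 Q1 Qn1 zN.
have ps1 : (1 < p ^ s)%N by rewrite -(exp1n s) ltn_exp2r// prime_gt1.
have Q0 : (0 < Q)%N.
  by case: Q Q1 {Qn1} => // /eqP; rewrite mod0n modn_small.
have [u Qu] : exists u, Q = (p ^ s * u + 1)%N.
  move/eqP: Q1; rewrite eqn_mod_dvd// => /dvdnP[u uQ].
  by exists u; rewrite mulnC -uQ subnK.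
have up : coprime u p.
  rewrite coprime_sym prime_coprime//; apply: contra Qn1 => /dvdnP[v uv].
  by rewrite Qu uv mulnCA -expnSr modnMDl.
set w := z ^+ (p ^ s); have wp : w ^+ p = 1 by rewrite -exprM -expnSr.
set xi := w ^+ u; have xip : xi ^+ p = 1 by rewrite exprAC wp expr1n.
(* As s > 0, p divides Q - 1. *)
have xiQ : xi ^+ Q = xi.
  rewrite Qu -[s]prednK// expnS -mulnA exprD expr1 exprM xip expr1n.
  by rewrite mul1r.
have zQ t : z ^+ (Q ^ t) = z * xi ^+ t.
  elim: t => [|t IH]; first by rewrite expn0 mulr1.
  rewrite expnSr exprM IH exprMn exprAC xiQ {1}Qu exprD exprM expr1 -/w -/xi.
  by rewrite exprSr [xi * z]mulrC -mulrA [xi * _]mulrC.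
under eq_bigr do rewrite zQ.
rewrite -mulr_sumr; have [w1|w1] := eqVneq w 1.
  rewrite mulrC; congr (_ * _); under eq_bigr do rewrite /xi w1 !expr1n.
  by rewrite sumr_const card_ord.
have xi1 : xi - 1 != 0.
  by apply: contraNneq w1 => /subr0_eq/(unity_root_powX_coprime wp up) ->.
suff -> : \sum_(t < p) xi ^+ t = 0 by rewrite mulr0.
by apply: (mulfI xi1); rewrite mulr0 -subrX1 xip subrr.
Qed.

(* False for a = 1: with p = 2 and Q = 3, one has 3^2 = 1 mod 2^3.            *)
Lemma expn_prime_level (p a Q : nat) : prime p -> (1 < a)%N ->
  (Q = 1 %[mod p ^ a])%N -> (Q != 1 %[mod p ^ a.+1])%N ->
  (Q ^ p = 1 %[mod p ^ a.+1])%N /\ (Q ^ p != 1 %[mod p ^ a.+2])%N.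
Proof.
move=> p_pr a1 Q1 Qn1; have pa0 : (0 < p ^ a)%N by rewrite expn_gt0 prime_gt0.
have pa1 : (1 < p ^ a)%N.
  by rewrite -(exp1n a) ltn_exp2r ?(ltnW a1)// prime_gt1.
have Q0 : (0 < Q)%N.
  by case: Q Q1 {Qn1} => // /eqP; rewrite mod0n modn_small.
have [u Qu] : exists u, Q = (p ^ a * u + 1)%N.
  move/eqP: Q1; rewrite eqn_mod_dvd// => /dvdnP[u uQ].
  by exists u; rewrite mulnC -uQ subnK.
have pu : ~~ (p %| u)%N.
  apply: contra Qn1 => /dvdnP[v uv].
  by rewrite Qu uv mulnCA -expnSr modnMDl.
have expE (y m : nat) : exists r, ((y + 1) ^ m = y * (m + y * r) + 1)%N.
  elim: m => [|m [r IH]]; first by exists 0%N; rewrite !muln0.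
  by exists (m + r + y * r)%N; rewrite expnS IH; ring.
have [r QE] := expE (p ^ a * u)%N p.
(* Since a >= 2, the quadratic term, a multiple of p^(2a), is divisible by p^(a+2), so only u
   p^(a+1) survives modulo p^(a+2). *)
have {}QE : (Q ^ p = u * (1 + u * r * p ^ a.-2 * p) * p ^ a.+1 + 1)%N.
  rewrite Qu QE expnSr.
  have -> : (p ^ a = p ^ a.-2 * p * p)%N.
    by rewrite -!expnSr; case: (a) a1 => [|[]].
  by ring.
split; first by rewrite QE modnMDl.
rewrite eqn_mod_dvd ?expn_gt0 ?Q0// QE addnK [in X in (X %| _)%N]expnS.
rewrite dvdn_pmul2r ?expn_gt0 ?prime_gt0// Euclid_dvdM// negb_or pu/=.
by rewrite dvdn_addl ?dvdn_mull// Euclid_dvd1.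
Qed.

(** Euler's theorem gives a power q of l congruent to 1; m is the p-adic valuation of q - 1, and
    each further p-th power raises this level by exactly one. *)
Lemma expn_levels (p l : nat) : prime p -> prime l -> p <> l ->
  exists2 m, (1 < m)%N & forall s, (m <= s)%N -> exists r,
    (l ^ r = 1 %[mod p ^ s])%N /\ (l ^ r != 1 %[mod p ^ s.+1])%N.
Proof.
move=> p_pr l_pr p_neq_l; have p0 := prime_gt0 p_pr.
have lp : coprime l (p ^ 2).
  by rewrite coprimeXr// prime_coprime// dvdn_prime2//; apply/eqP => /esym.
(* The modulus p^2 rather than p makes the starting level at least 2, as [expn_prime_level]
   requires. *)
set t := totient (p ^ 2); set q := (l ^ t)%N.
have q1 : (1 < q)%N.
  by rewrite -(exp1n t) ltn_exp2r ?prime_gt1// totient_gt0 expn_gt0 p0.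
have q_dvd n : (q == 1 %[mod p ^ n])%N = (n <= logn p (q - 1))%N.
  by rewrite eqn_mod_dvd ?(ltnW q1)// pfactor_dvdn// subn_gt0.
exists (logn p (q - 1)); first by rewrite -q_dvd; apply/eqP/Euler_exp_totient.
move=> s /subnK <-; elim: (s - _)%N => [|k [r [r1 r2]]].
  by exists t; split; [apply/eqP|]; rewrite q_dvd// -ltnNge ltnS.
exists (r * p)%N; rewrite expnM; apply: expn_prime_level => //.
rewrite (leq_trans _ (leq_addl _ _))// -q_dvd.
exact/eqP/Euler_exp_totient.
Qed.

Lemma class_sum_neq0 (V : zmodType) (T : eqType) (I : finType) (y : I -> T)
    (g : I -> V) :
  \sum_i g i != 0 -> exists i0, \sum_(i | y i == y i0) g i != 0.
Proof.
move=> S0; apply: contrapT => /forallNP S_eq0; case/eqP: S0.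
(* A representative of the fibre through [i]: the fibres are thus indexed by the finite type
   [option I], although [T] may be infinite. *)
pose f i := [pick j | y j == y i].
rewrite (partition_big f xpredT)//= big1// => o _.
have [[i0 /eqP fi0]|no] := pselect (exists i0, f i0 == o); last first.
  by rewrite big1// => i fi; case: no; exists i.
rewrite (eq_bigl (fun i => y i == y i0)); first by apply/eqP/negPn/negP/S_eq0.
move=> i; rewrite -fi0; apply/eqP/eqP => [|yi]; last first.
  by apply: eq_pick => j /=; rewrite yi.
rewrite /f; case: pickP => [j /eqP <-|/(_ i)]; last by rewrite eqxx.
by case: pickP => [j' /eqP <- [->]|/(_ i0)]; rewrite ?eqxx.
Qed.

(** * Orders of integer polynomials at roots of unity *)

Section Valuation.
Variables (K : fieldType) (l : nat) (l_pr : prime l) (ord : K -> \bar rat).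
Hypothesis ord_eqy : forall x, ord x = +oo%E <-> x = 0.
Hypothesis ordM : forall x y, ord (x * y) = (ord x + ord y)%E.
Hypothesis ordD : forall x y, (Order.min (ord x) (ord y) <= ord (x + y)%R)%E.
Hypothesis ord_l : ord l%:R = 1%:E.

Local Notation evZ f z := (map_poly (intr : int -> K) f).[z].
Local Notation ord_gt c x := (c%:R%:E < ord x%R)%E.

Lemma ord1 : ord 1 = 0%E.
Proof.
have := ordM l%:R 1; rewrite mulr1 ord_l; case: (ord 1) => [r| |] //= [].
by rewrite -[1 in LHS]addr0 => /addrI <-.
Qed.

Lemma ord_fin x : x != 0 -> exists r : rat, ord x = r%:E.
Proof.
move=> x0; have := ordM x x^-1; rewrite mulfV// ord1.
case: (ord x) (ord_eqy x) => [r| |] //; first by exists r.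
by case=> /(_ erefl) x00; rewrite x00 eqxx in x0.
Qed.

Lemma ordX x n (r : rat) : ord x = r%:E -> ord (x ^+ n) = (n%:R * r)%:E.
Proof.
move=> xr; elim: n => [|n IH]; first by rewrite expr0 mul0r ord1.
by rewrite exprS ordM IH xr -EFinD -natr1 mulrDl mul1r addrC.
Qed.

Lemma ord_unity z N : (0 < N)%N -> z ^+ N = 1 -> ord z = 0%E.
Proof.
move=> N0 zN; have z0 : z != 0.
  by apply/eqP => z0; move/eqP: zN; rewrite z0 expr0n gtn_eqF// eq_sym oner_eq0.
have [r zr] := ord_fin z0; have := ordX N zr; rewrite zN ord1 => -[] /esym/eqP.
by rewrite mulf_eq0 pnatr_eq0 gtn_eqF//= => /eqP r0; rewrite zr r0.
Qed.

Lemma ordN x : ord (- x) = ord x.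
Proof.
by rewrite -mulN1r ordM (@ord_unity (-1) 2) ?add0e// sqrrN expr1n.
Qed.

Lemma ord_leD c x y : (c <= ord x -> c <= ord y -> c <= ord (x + y))%E.
Proof. by move=> cx cy; apply: le_trans (ordD x y); rewrite le_min cx. Qed.

Lemma ord_ltD c x y : (c < ord x -> c < ord y -> c < ord (x + y))%E.
Proof. by move=> cx cy; apply: lt_le_trans (ordD x y); rewrite lt_min cx. Qed.

Lemma ord_zero : ord 0 = +oo%E.
Proof. exact/ord_eqy. Qed.

Lemma ord_le_sum (I : Type) (s : seq I) (P : pred I) (G : I -> K) c :
  (forall i, P i -> (c <= ord (G i))%E) ->
  (c <= ord (\sum_(i <- s | P i) G i))%E.
Proof.
move=> cG; elim/big_rec: _ => [|i x Pi cx]; first by rewrite ord_zero leey.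
exact/ord_leD/cx/cG.
Qed.

Lemma ord_lt_sum (I : Type) (s : seq I) (P : pred I) (G : I -> K) (c : rat) :
  (forall i, P i -> (c%:E < ord (G i))%E) ->
  (c%:E < ord (\sum_(i <- s | P i) G i))%E.
Proof.
move=> cG; elim/big_rec: _ => [|i x Pi cx]; first by rewrite ord_zero ltry.
exact/ord_ltD/cx/cG.
Qed.

Lemma ord_ge0M x y : (0 <= ord x -> 0 <= ord y -> 0 <= ord (x * y))%E.
Proof. by move=> x0 y0; rewrite ordM adde_ge0. Qed.

Lemma ord_gtM c x y : (0 <= ord x -> c < ord y -> c < ord (x * y))%E.
Proof.
by move=> x0 cy; rewrite ordM; apply: lt_le_trans cy _; rewrite leeDr.
Qed.

Lemma ord_ge0X x n : (0 <= ord x -> 0 <= ord (x ^+ n))%E.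
Proof.
by move=> x0; elim: n => [|n IH]; rewrite ?expr0 ?ord1// exprS ord_ge0M.
Qed.

Lemma ord_nat_ge0 n : (0 <= ord n%:R)%E.
Proof.
by elim: n => [|n IH]; rewrite ?ord_zero ?leey// -natr1 ord_leD ?ord1.
Qed.

Lemma ord_int_ge0 (c : int) : (0 <= ord c%:~R)%E.
Proof. by case: c => n; rewrite ?NegzE ?mulrNz ?ordN ord_nat_ge0. Qed.

Lemma ord_coprime n : coprime n l -> ord n%:R = 0%E.
Proof.
move=> nl; apply/eqP; rewrite eq_le ord_nat_ge0 andbT leNgt.
apply/negP => n_gt0.
have [n0|n0] := posnP n.
  by move: nl l_pr; rewrite n0 /coprime gcd0n => /eqP ->.
case: (egcdnP l n0) => u v uv _; rewrite (eqP nl) in uv.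
have : (0 < ord 1)%E.
  have -> : 1 = u%:R * n%:R - v%:R * l%:R :> K.
    by rewrite -!natrM uv natrD addrC addKr.
  apply: ord_ltD; first by rewrite ord_gtM ?ord_nat_ge0.
  by rewrite ordN ord_gtM ?ord_nat_ge0// ord_l lte_fin.
by rewrite ord1 ltxx.
Qed.

Lemma ord_evZ_ge0 (f : {poly int}) z : (0 <= ord z)%E -> (0 <= ord (evZ f z))%E.
Proof.
move=> z0; elim/poly_ind: f => [|f c IH].
  by rewrite rmorph0 horner0 ord_zero leey.
rewrite rmorphD rmorphM /= map_polyX map_polyC hornerMXaddC.
by rewrite ord_leD ?ord_int_ge0// ord_ge0M.
Qed.

(** Induction on c, for all f at once. For c = 0, f(z^(l^r)) and f(z)^(l^r) differ by l times an
    element of non-negative order. The inductive step replaces f by some h with ord f = 1 + ord h at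
    both z and z^(l^r). *)
Lemma ord_frobenius (N c r : nat) (f : {poly int}) z :
  (0 < N)%N -> coprime l N -> z ^+ N = 1 ->
  ord_gt c (evZ f z) -> ord_gt c (evZ f (z ^+ (l ^ r))).
Proof.
move=> N0 lN zN; have frobE (g : {poly int}) r' : exists h, forall y,
    evZ g y ^+ (l ^ r') = evZ g (y ^+ (l ^ r')) + l%:R * evZ h y.
  have [h E] := frobenius_polyZ r' g l_pr; exists h => y.
  have /(congr1 (fun g => evZ g y)) := E.
  rewrite rmorphXn/= horner_exp => ->.
  rewrite rmorphD rmorphM /= hornerD hornerM rmorph_nat -[l%:R]polyC_natr.
  by rewrite hornerC map_comp_poly map_polyXn horner_comp hornerXn.
have root_ge0 y : y ^+ N = 1 -> forall g, (0 <= ord (evZ g y))%E.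
  by move=> yN g; rewrite ord_evZ_ge0// (@ord_unity y N).
have rootX y m : y ^+ N = 1 -> (y ^+ m) ^+ N = 1.
  by move=> yN; rewrite -exprM mulnC exprM yN expr1n.
have gt0X x m : (0 < m)%N -> (0 < ord x)%E -> (0 < ord (x ^+ m))%E.
  by case: m => // m _ x0; rewrite exprSr ord_gtM// ord_ge0X// ltW.
have step0 y g : y ^+ N = 1 -> (0 < ord (evZ g y))%E ->
    (0 < ord (evZ g (y ^+ (l ^ r))))%E.
  move=> yN gy; have [h /(_ y)E] := frobE g r.
  rewrite (_ : evZ g _ = evZ g y ^+ (l ^ r) - l%:R * evZ h y); last first.
    by rewrite E addrK.
  apply: ord_ltD; first by rewrite gt0X // expn_gt0 prime_gt0.
  by rewrite ordN mulrC ord_gtM ?root_ge0// ord_l lte_fin.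
(* By Euler's theorem the q-th power fixes every N-th root of unity. *)
set q := (l ^ totient N)%N.
have rootq y : y ^+ N = 1 -> y ^+ q = y.
  move=> yN; rewrite -(expr_mod _ yN) Euler_exp_totient//.
  by rewrite expr_mod.
have q_gt1 : (1 < q)%N.
  by rewrite -(exp1n (totient N)) ltn_exp2r ?prime_gt1// totient_gt0.
have ord_unit y g : y ^+ N = 1 -> (0 < ord (evZ g y))%E ->
    ord (1 - evZ g y ^+ q.-1) = 0%E.
  move=> yN gy; have gq : (0 < ord (evZ g y ^+ q.-1))%E.
    by rewrite gt0X // -ltnS prednK // ltnW.
  apply/eqP; rewrite eq_le ord_leD ?ord1 ?ordN ?(ltW gq)// andbT leNgt.
  apply/negP => d0; have := ord_ltD d0 gq.
  by rewrite subrK ord1 ltxx.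
elim: c f => [|c IH] f fz; first exact: step0.
have fz0 : (0 < ord (evZ f z))%E by apply: le_lt_trans fz; rewrite lee_fin.
have [h E] := frobE f (totient N).
(* (1 - f(y)^(q-1)) f(y) = f(y^q) - f(y)^q = - l h(y), and the first factor   *)
(* is a unit: f can be divided by l, simultaneously at y = z and y = z^(l^r). *)
have ordE y : y ^+ N = 1 -> (0 < ord (evZ f y))%E ->
    ord (evZ f y) = (1 + ord (evZ h y))%E.
  move=> yN fy; rewrite -ord_l -ordM.
  rewrite -[RHS]ordN -[LHS]add0e -(ord_unit y f yN fy) -ordM.
  congr (ord _).
  rewrite mulrBl mul1r -exprSr prednK ?(ltnW q_gt1)// E.
  by rewrite rootq // opprD addrA subrr add0r.
rewrite ordE// ?step0// ?rootX//.
have ltS x : (c.+1%:R%:E < 1 + x)%E = (c%:R%:E < x :> \bar rat)%E.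
  case: x => [x| |] //=; rewrite ?ltry// -EFinD !lte_fin.
  by rewrite -natr1 addrC ltrD2l.
by move: fz; rewrite ordE// !ltS; apply: IH.
Qed.

(** * Projection onto classes modulo mu_(p^m) *)

Variables (p : nat) (p_pr : prime p) (p_neq_l : p <> l).
Hypothesis prim_rootE :
  forall N, coprime N l -> (0 < N)%N -> exists z : K, N.-primitive_root z.

Lemma coprime_p_l s : coprime (p ^ s) l.
Proof. by rewrite coprimeXl// prime_coprime// dvdn_prime2//; apply/eqP. Qed.

(** Sum over the conjugates z -> z^(Q^t) with Q = l^r: each conjugate sum keeps the bound by
    [ord_frobenius], the total is p times the wanted partial sum, and p has order 0. *)
Lemma ord_project_step (s r c : nat) (I : finType) (P : pred I) (b : I -> int)
    (z : I -> K) : (0 < s)%N ->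
  (l ^ r = 1 %[mod p ^ s])%N -> (l ^ r != 1 %[mod p ^ s.+1])%N ->
  (forall i, P i -> z i ^+ (p ^ s.+1) = 1) ->
  ord_gt c (\sum_(i | P i) (b i)%:~R * z i) ->
  ord_gt c (\sum_(i | P i && (z i ^+ (p ^ s) == 1)) (b i)%:~R * z i).
Proof.
move=> s0 Q1 Qn1 zN.
have N0 : (0 < p ^ s.+1)%N by rewrite expn_gt0 prime_gt0.
have [zeta zetaP] := prim_rootE (coprime_p_l s.+1) N0.
have [e ze] : exists e : I -> nat, forall i, P i -> z i = zeta ^+ e i.
  exists (fun i => if z i ^+ (p ^ s.+1) =P 1 is ReflectT h
    then val (sval (prim_rootP zetaP h)) else 0%N) => i Pi.
  by case: eqP => [h|]; [case: prim_rootP | rewrite zN].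
(* All z_i are powers of [zeta], so the sum and its conjugates are values of one integer polynomial
   at powers of [zeta]. *)
set f : {poly int} := \sum_(i | P i) (b i)%:P * 'X^(e i).
have fE t : evZ f (zeta ^+ t) = \sum_(i | P i) (b i)%:~R * z i ^+ t.
  rewrite rmorph_sum /= horner_sum; apply: eq_bigr => i Pi.
  rewrite rmorphM /= map_polyC map_polyXn hornerCM hornerXn ze//.
  by rewrite -!exprM mulnC.
have -> : \sum_(i | P i) (b i)%:~R * z i = evZ f zeta.
  by rewrite -[zeta]expr1 fE.
move=> fz.
have : ord_gt c (\sum_(t < p) evZ f (zeta ^+ ((l ^ r) ^ t))).
  apply: (ord_lt_sum) => t _; rewrite -expnM.
  apply: (ord_frobenius _ N0) => //.
    by rewrite coprime_sym coprime_p_l.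
  exact: prim_expr_order.
under eq_bigr do rewrite fE.
rewrite exchange_big /=.
under eq_bigr => i Pi do
  rewrite -mulr_sumr (sum_unity_root_conj p_pr s0 Q1 Qn1 (zN i Pi)).
rewrite (_ : \sum_(i | P i) _ =
  p%:R * \sum_(i | P i && (z i ^+ (p ^ s) == 1)) (b i)%:~R * z i).
  rewrite ordM (ord_coprime) ?add0e//.
  by rewrite -[p]expn1 coprime_p_l.
rewrite mulr_sumr big_mkcondr; apply: eq_bigr => i _.
by case: ifP => _; rewrite ?mulr0// mulrCA.
Qed.

Variable m : nat.
Hypothesis m_gt0 : (0 < m)%N.
Hypothesis levels : forall s, (m <= s)%N -> exists r,
  (l ^ r = 1 %[mod p ^ s])%N /\ (l ^ r != 1 %[mod p ^ s.+1])%N.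

Lemma ord_project (n c : nat) (I : finType) (P : pred I) (b : I -> int)
    (z : I -> K) :
  (forall i, P i -> z i ^+ (p ^ n) = 1) ->
  ord_gt c (\sum_(i | P i) (b i)%:~R * z i) ->
  ord_gt c (\sum_(i | P i && (z i ^+ (p ^ m) == 1)) (b i)%:~R * z i).
Proof.
have root_le a d (y : K) : (a <= d)%N -> y ^+ (p ^ a) = 1 -> y ^+ (p ^ d) = 1.
  by move=> /subnKC <- ya; rewrite expnD exprM ya expr1n.
have [nm|mn] := leqP n m.
  move=> zn; congr (_ < ord _)%E; apply: eq_bigl => i.
  by case Pi: (P i) => //=; rewrite (root_le n m) ?eqxx ?zn.
elim: n mn P => // n IH; rewrite ltnS => mn P zn Pgt.
have [r [r1 r2]] := levels mn.
have step := ord_project_step (leq_trans m_gt0 mn) r1 r2 zn Pgt.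
have imp i : (P i && (z i ^+ (p ^ n) == 1)) && (z i ^+ (p ^ m) == 1) =
  P i && (z i ^+ (p ^ m) == 1).
  rewrite -andbA; congr andb; apply: andb_idl => /eqP zm.
  by apply/eqP/(root_le m n).
move: mn; rewrite leq_eqVlt => /predU1P[->//|mn].
rewrite -(eq_bigl _ _ imp).
by apply: IH => // i /andP[_ /eqP].
Qed.

(** Multiplying by the inverse of z_i0 preserves orders and moves the class of z_i0 to mu_(p^m)
    itself, where [ord_project] applies. *)
Lemma ord_project_class (n c : nat) (I : finType) (b : I -> int) (z : I -> K)
    (i0 : I) :
  (forall i, z i ^+ (p ^ n) = 1) ->
  ord_gt c (\sum_i (b i)%:~R * z i) ->
  ord_gt c (\sum_(i | z i ^+ (p ^ m) == z i0 ^+ (p ^ m)) (b i)%:~R * z i).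
Proof.
move=> zn Sgt; have pn0 : (0 < p ^ n)%N by rewrite expn_gt0 prime_gt0.
have z0 i : z i != 0.
  apply/eqP => zi; have /eqP := zn i; rewrite zi expr0n gtn_eqF//.
  by rewrite eq_sym oner_eq0.
have ordz i : ord (z i) = 0%E by exact: (ord_unity pn0 (zn i)).
pose y i := (z i0)^-1 * z i.
have yE (P : pred I) : \sum_(i | P i) (b i)%:~R * z i =
    z i0 * \sum_(i | P i) (b i)%:~R * y i.
  by rewrite mulr_sumr; apply: eq_bigr => i _; rewrite mulrCA mulVKf.
move: Sgt; rewrite !yE !ordM !ordz !add0e => Sgt.
rewrite (eq_bigl (fun i => true && (y i ^+ (p ^ m) == 1))).
  apply: (@ord_project n) => // i _.
  by rewrite exprMn exprVn !zn invr1 mulr1.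
move=> i /=; rewrite exprMn exprVn; apply/eqP/eqP => [->|].
  by rewrite mulVf// expf_neq0.
by move=> zz; rewrite -[LHS](mulVKf (expf_neq0 (p ^ m) (z0 i0))) zz mulr1.
Qed.


(** * Uniform bound and exact order *)

(** The projection lemmas treat natural thresholds only; this lets mu serve as one. *)
Lemma ord_int_nat (c : int) : c != 0 -> exists s : nat, ord c%:~R = s%:R%:E.
Proof.
move=> c0; have : (0 < `|c|)%N by rewrite absz_gt0.
move=> /(pfactor_coprime l_pr)[u lu cE]; exists (logn l `|c|).
have -> : ord c%:~R = ord (`|c|%N%:R : K).
  by case: (c) => n //; rewrite NegzE abszN mulrNz (ordN).
rewrite {1}cE natrM ordM (ord_coprime) 1?coprime_sym//.
by rewrite add0e natrX (ordX _ ord_l) mulr1.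
Qed.

(** If the full sum had order above C, so would a non-zero class sum. Divided by one of its roots of
    unity, a class sum combines elements of mu_(p^m) with coefficients b_i, and this leaves finitely
    many values, whatever n is. *)
Lemma ord_sum_bounded (I : finType) (b : I -> int) :
  exists C : nat, forall n (z : I -> K), (forall i, z i ^+ (p ^ n) = 1) ->
    \sum_i (b i)%:~R * z i != 0 ->
    (ord (\sum_i (b i)%:~R * z i)%R <= C%:R%:E)%E.
Proof.
set N := (p ^ m)%N.
have N0 : (0 < N)%N by rewrite expn_gt0 prime_gt0.
have [zeta zetaP] := prim_rootE (coprime_p_l m) N0.
(* [phi] records which indices lie in the class and with which power of [zeta]; [None] drops an
   index. *)
pose S (phi : {ffun I -> option 'I_N}) : K :=
  \sum_i (b i)%:~R * (if phi i is Some t then zeta ^+ t else 0).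
have /choice[B SB] phi :
    exists B : nat, S phi != 0 -> (ord (S phi) <= B%:R%:E)%E.
  have [S0|/(ord_fin)[r ->]] := eqVneq (S phi) 0.
    by exists 0%N.
  exists (Num.bound `|r|) => _; rewrite lee_fin.
  exact: le_trans (ler_norm r) (ltW (archi_boundP (normr_ge0 r))).
exists (\max_phi B phi)%N => n z zn S0; rewrite leNgt; apply/negP => Sgt.
have [i0 K0] := class_sum_neq0 (fun i => z i ^+ N) S0.
have Kgt := ord_project_class i0 zn Sgt.
have pn0 : (0 < p ^ n)%N by rewrite expn_gt0 prime_gt0.
have z0 i : z i != 0.
  apply/eqP => zi; have /eqP := zn i; rewrite zi expr0n gtn_eqF//.
  by rewrite eq_sym oner_eq0.
have ordz i : ord (z i) = 0%E by exact: (ord_unity pn0 (zn i)).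
pose phi : {ffun I -> option 'I_N} :=
  [ffun i => [pick t : 'I_N | z i == z i0 * zeta ^+ t]].
have KE : \sum_(i | z i ^+ N == z i0 ^+ N) (b i)%:~R * z i = z i0 * S phi.
  rewrite mulr_sumr big_mkcond; apply: eq_bigr => i _; rewrite mulrCA ffunE.
  case: pickP => [t /eqP zi|no].
    by rewrite zi exprMn exprAC (prim_expr_order zetaP) expr1n mulr1 eqxx.
  rewrite mulr0 mulr0; case: eqP => // zi.
  have : (z i / z i0) ^+ N = 1 by rewrite exprMn zi exprVn mulfV// expf_neq0.
  case/(prim_rootP zetaP) => t zt; have := no t.
  by rewrite -zt mulrCA mulfV// mulr1 eqxx.
rewrite KE mulf_eq0 (negPf (z0 i0)) in K0.
rewrite KE ordM ordz add0e ltNge in Kgt; move/negP: Kgt; apply.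
by apply: le_trans (SB _ K0) _; rewrite lee_fin ler_nat leq_bigmax.
Qed.

Lemma ord_sum_ge_min (I : finType) (b : I -> int) (z : I -> K) :
  (forall i, ord (z i) = 0%E) ->
  (\big[Order.min/+oo]_i ord (b i)%:~R <= ord (\sum_i (b i)%:~R * z i)%R)%E.
Proof.
move=> ordz; apply: (ord_le_sum) => i _.
by rewrite ordM ordz adde0 bigmin_le.
Qed.

Lemma min_ord_attained (I : finType) (b : I -> int) : (exists i, b i != 0) ->
  exists i (s : nat), \big[Order.min/+oo%E]_i ord (b i)%:~R = s%:R%:E /\
    ord (b i)%:~R = s%:R%:E.
Proof.
move=> [i bi]; have [s sE] := ord_int_nat bi.
set mu := \big[_/_]_i _.
have : mu = +oo%E \/ exists i, mu = ord (b i)%:~R.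
  rewrite /mu; elim/big_ind: _ => [|x y xP yP|j _]; first by left.
    by case: leP.
  by right; exists j.
case=> [muy|[j mu_j]].
  have : (mu <= ord (b i)%:~R)%E by exact: bigmin_le.
  by rewrite muy sE.
have [bj0|bj] := eqVneq (b j) 0; last first.
  by have [t tE] := ord_int_nat bj; exists j, t; rewrite mu_j.
have : (mu <= ord (b i)%:~R)%E by exact: bigmin_le.
by rewrite mu_j bj0 (ord_zero) sE.
Qed.

(** Every class is a singleton, so an order above the minimum would pass to a single term attaining
    that minimum. *)
Lemma ord_sum_separated (n : nat) (I : finType) (b : I -> int) (z : I -> K) :
  (exists i, b i != 0) -> (forall i, z i ^+ (p ^ n) = 1) ->
  (forall i j, z i ^+ (p ^ m) = z j ^+ (p ^ m) -> i = j) ->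
  ord (\sum_i (b i)%:~R * z i) = \big[Order.min/+oo%E]_i ord (b i)%:~R.
Proof.
move=> b0 zn zinj; have pn0 : (0 < p ^ n)%N by rewrite expn_gt0 prime_gt0.
have ordz i : ord (z i) = 0%E by exact: (ord_unity pn0 (zn i)).
have [i0 [s [muE bE]]] := min_ord_attained b0.
apply/eqP; rewrite eq_le ord_sum_ge_min// andbT muE leNgt; apply/negP => Sgt.
have := ord_project_class i0 zn Sgt.
rewrite (eq_bigl (pred1 i0)) => [|i]; last first.
  by apply/eqP/eqP => [/zinj|->].
by rewrite big_pred1_eq ordM ordz adde0 bE ltxx.
Qed.

End Valuation.

(** * Divisibility by p^n in the p-adic integers *)

Section PadicResidues.
Variables (p : nat) (p_pr : prime p).
Local Notation Zp := (padic_int p_pr).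

Lemma zp_resD (x y : Zp) n :
  zp_res (x + y) n = ((zp_res x n + zp_res y n) %% p ^ n)%N.
Proof. by []. Qed.

Lemma zp_resMn (x : Zp) k n : zp_res (x *+ k) n = ((k * zp_res x n) %% p ^ n)%N.
Proof.
elim: k => [|k IH]; first by rewrite mulr0n.
by rewrite mulrSr zp_resD IH modnDml mulSn addnC.
Qed.

Lemma zp_res_eq0 (y : Zp) n : zp_res y n = 0%N -> exists x : Zp, y = x *+ p ^ n.
Proof.
move=> y0; have pn0 : (0 < p ^ n)%N by rewrite expn_gt0 prime_gt0.
have dvd j : (p ^ n %| zp_res y (n + j))%N.
  by rewrite /dvdn (zp_res_modn _ (leq_addr j n)) y0 mod0n.
(* Division by p^n costs n digits, so level j of the quotient is read from level n + j of [y]. *)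
pose u j := (zp_res y (n + j) %/ p ^ n)%N.
have uP j : (u j.+1 = u j %[mod p ^ j])%N.
  apply/eqP; rewrite -(eqn_pmul2l pn0) !muln_modr -!expnD ![(p ^ n * _)%N]mulnC.
  by rewrite !divnK// addnS zp_resS.
exists (zp_of p_pr uP); apply: zp_ext => j.
rewrite zp_resMn /= modnMmr mulnC divnK// (zp_res_modn _ (leq_addl n j)).
by rewrite zp_resm.
Qed.

Lemma zp_res_eq (x y : Zp) n : zp_res x n = zp_res y n ->
  exists z : Zp, x = y + z *+ p ^ n.
Proof.
move=> xy; have [|z zE] := @zp_res_eq0 (x - y) n; last first.
  by exists z; rewrite -zE addrC subrK.
have := zp_resD (x - y) y n; rewrite subrK xy => /eqP.
rewrite -{1}zp_resm -{1}[zp_res y n]add0n eqn_modDr mod0n eq_sym.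
by rewrite zp_resm => /eqP.
Qed.

End PadicResidues.

(** * Characters of Gamma_n by exponent vectors *)

Section CharacterOf.
Variables (p : nat) (p_pr : prime p) (d : nat) (K : fieldType).
Variables (n : nat) (zeta : K).
Hypothesis zetaP : (p ^ n).-primitive_root zeta.
Local Notation Gamma := (Gam p_pr d).

(** The character with i-th generator sent to zeta^(e i). Exponent vectors parametrise the whole
    dual bijectively, by [dual_char_of] and [char_of_inj]. *)
Definition char_of (e : {ffun 'I_d -> 'I_(p ^ n)}) (x : Gamma) : K :=
  \prod_(i < d) (zeta ^+ e i) ^+ zp_res (x 0 i) n.

Let zetaX j k : (zeta ^+ j) ^+ (k %% p ^ n) = (zeta ^+ j) ^+ k.
Proof. by rewrite expr_mod// exprAC (prim_expr_order zetaP) expr1n. Qed.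

Lemma char_ofX e x : char_of e x ^+ (p ^ n) = 1.
Proof.
rewrite -prodrXl big1// => i _.
by rewrite -!exprM mulnC exprM (prim_expr_order zetaP) expr1n.
Qed.

Lemma char_ofD e x y : char_of e (x + y) = char_of e x * char_of e y.
Proof.
rewrite -big_split; apply: eq_bigr => i _.
by rewrite mxE zp_resD zetaX exprD.
Qed.

Lemma char_of0 e : char_of e 0 = 1.
Proof. by rewrite /char_of big1// => i _; rewrite mxE /= mod0n. Qed.

Lemma char_of_gam e i : char_of e (gam p_pr i) = zeta ^+ e i.
Proof.
rewrite /char_of (bigD1 i)//= big1 => [|j ji].
  by rewrite mxE !eqxx /= zetaX expr1 mulr1.
by rewrite mxE (negPf ji) andbF /= mod0n.
Qed.

Lemma dual_mulrn (w : Gamma -> K) x k : Gam_dual n w -> w (x *+ k) = w x ^+ k.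
Proof.
case=> w0 wD _; elim: k => [|k IH]; first by rewrite mulr0n w0.
by rewrite mulrSr wD IH exprSr.
Qed.

Lemma char_of_dual e : Gam_dual n (char_of e).
Proof.
split; [exact: char_of0 | exact: char_ofD|] => x.
suff E k : char_of e (x *+ k) = char_of e x ^+ k by rewrite E char_ofX.
elim: k => [|k IH]; first by rewrite mulr0n char_of0.
by rewrite mulrSr char_ofD IH exprSr.
Qed.

Lemma dual_char_of w : Gam_dual n w -> exists e, w = char_of e.
Proof.
move=> wP; have [w0 wD wX] := wP.
have wg i : w (gam p_pr i) ^+ (p ^ n) = 1 by rewrite -dual_mulrn.
exists [ffun i => sval (prim_rootP zetaP (wg i))]; apply/funext => x.
have wgE i :
    w (gam p_pr i) = zeta ^+ [ffun i => sval (prim_rootP zetaP (wg i))] i.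
  by rewrite ffunE; case: prim_rootP.
rewrite /char_of; under eq_bigr do rewrite -wgE -dual_mulrn//.
(* An integer point congruent to x modulo p^n; w takes the same value at both, being trivial on p^n
   Gamma. *)
pose x0 := \sum_(i < d) gam p_pr i *+ zp_res (x 0 i) n.
have -> : \prod_(i < d) w (gam p_pr i *+ zp_res (x 0 i) n) = w x0.
  by rewrite /x0 (big_morph w wD w0).
have x0E i : zp_res (x0 0 i) n = zp_res (x 0 i) n.
  suff -> : x0 0 i = 1 *+ zp_res (x 0 i) n.
    by rewrite zp_resMn /= modnMmr muln1 zp_resm.
  rewrite /x0 summxE (bigD1 i)//= big1 => [|j ji]; last first.
    by rewrite mulmxnE mxE [i == j]eq_sym (negPf ji) andbF mul0rn.
  by rewrite addr0 mulmxnE mxE !eqxx.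
have /choice[y yE] i : exists y, x 0 i = x0 0 i + y *+ p ^ n.
  by apply: zp_res_eq; rewrite x0E.
have -> : x = x0 + (\row_i y i) *+ p ^ n.
  by apply/rowP => i; rewrite mxE mulmxnE mxE yE.
by rewrite wD wX mulr1.
Qed.

Lemma char_of_inj : injective char_of.
Proof.
move=> e e' ee'; apply/ffunP => i; apply: val_inj => /=.
have /(congr1 (fun w => w (gam p_pr i))) := ee'.
rewrite !char_of_gam => /eqP; rewrite (eq_prim_root_expr zetaP) !modn_small//.
by move/eqP.
Qed.

Lemma char_eval_char_of e (F : Phi p_pr d) (k : nat) (b : 'I_k -> int)
    (a : 'I_k -> Gamma) : injective a -> F = \sum_(i < k) << b i *g a i >> ->
  char_eval n (char_of e) F = \sum_(i < k) (b i)%:~R * char_of e (a i).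
Proof.
move=> a_inj FE; rewrite /char_eval.
have coeffF x : coeff x F = \sum_(i < k) b i * (a i == x)%:R.
  by rewrite FE raddf_sum; apply: eq_bigr => i _; exact: coeffU.
under eq_bigr => x _.
  rewrite (_ : \prod_(i < d) _ = char_of e x); last first.
    by apply: eq_bigr => i _; rewrite char_of_gam.
  rewrite coeffF rmorph_sum mulr_suml /=.
  over.
rewrite exchange_big; apply: eq_bigr => i _ /=.
have bE : coeff (a i) F = b i.
  rewrite coeffF (bigD1 i)//= eqxx mulr1 big1 ?addr0// => j ji.
  by rewrite (inj_eq a_inj) (negPf ji) mulr0.
(* Some b_i may vanish; then a_i is outside [dom F] and both contributions are 0. *)
have [iF|iF] := boolP (a i \in dom F); last first.
  have bi0 : b i = 0 by rewrite -bE coeff_outdom.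
  by rewrite bi0 mul0r big1// => x _; rewrite mul0r mul0r.
rewrite (bigD1_seq (a i))//= ?uniq_dom// eqxx mulr1 big1 ?addr0// => x xi.
by rewrite eq_sym (negPf xi) mulr0 mul0r.
Qed.

End CharacterOf.

(** * Counting the exceptional characters *)

Lemma eqmod_cancel (p n m s r e e' : nat) : prime p -> (0 < r)%N ->
  (logn p r < s)%N -> (e * r * p ^ m = e' * r * p ^ m %[mod p ^ n])%N ->
  (e = e' %[mod p ^ (n - (m + s))])%N.
Proof.
move=> p_pr r0 rs; wlog le_ee' : e e' / (e' <= e)%N.
  move=> H E; case/orP: (leq_total e e') => le_e; last exact: H.
  by apply/esym/H.
move=> /eqP E; apply/eqP; move: E; rewrite !eqn_mod_dvd//; last first.
  by rewrite -!mulnA leq_mul2r le_ee' orbT.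
rewrite -!mulnA -mulnBl.
have [/eqP|e0] := posnP (e - e'); first by move=> /eqP ->; rewrite dvdn0.
have pm0 : (0 < p ^ m)%N by rewrite expn_gt0 prime_gt0.
rewrite !pfactor_dvdn ?muln_gt0 ?e0 ?r0// !lognM ?muln_gt0 ?r0// pfactorK//.
rewrite leq_subLR => /leq_trans; apply.
by rewrite addnC leq_add2r addnC leq_add2l ltnW.
Qed.

(** A non-zero coordinate of x leaves at most p^(m+s) choices for one exponent, the other d being
    free. Its valuation is below s, independent of n, and so is A. *)
Lemma card_char_of_torsion (p : nat) (p_pr : prime p) (d m : nat)
    (x : Gam p_pr d.+1) : x != 0 ->
  exists A n0, forall n (K : fieldType) (zeta : K), (n0 <= n)%N ->
    (p ^ n).-primitive_root zeta ->
    (#|[set e | char_of (n := n) zeta e x ^+ (p ^ m) == 1%R]|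
       <= A * p ^ (d * n))%N.
Proof.
move=> x0.
have [i0 xi0] : exists i, x 0 i != 0.
  apply: contrapT => /forallNP h; case/eqP: x0; apply/rowP => i.
  by rewrite mxE; apply/eqP/negPn/negP/h.
have [s xs] := zp_neq0P xi0.
(* The successor in A only gives [inord] its target type; n >= m + s ensures p^n = q p^(m+s)
   below. *)
exists (p ^ (m + s)).+1, (m + s)%N => n K zeta le_n zetaP.
have [r0 rs] := zp_logn xs (leq_trans (leq_addl m s) le_n).
set r := zp_res _ n in r0 rs.
pose q := (p ^ (n - (m + s)))%N.
have q0 : (0 < q)%N by rewrite expn_gt0 prime_gt0.
(* r has p-adic valuation below s, so the condition determines e i0 modulo q  *)
(* once the other coordinates of e are known.                                 *)
pose psi (e : {ffun 'I_d.+1 -> 'I_(p ^ n)}) :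
    {ffun 'I_d -> 'I_(p ^ n)} * 'I_(p ^ (m + s)).+1 :=
  ([ffun t => e (lift i0 t)], inord (e i0 %/ q)).
set B := [set e | _].
have psi_inj : {in B &, injective psi}.
  move=> e e'; rewrite !inE => /eqP eB /eqP e'B [/ffunP ee' /(congr1 val)].
  have lt_q (f : {ffun 'I_d.+1 -> 'I_(p ^ n)}) :
      (f i0 %/ q < (p ^ (m + s)).+1)%N.
    by rewrite ltnS ltnW// ltn_divLR// -expnD subnKC.
  rewrite /= !inordK// => ediv.
  have lift_eq t : e (lift i0 t) = e' (lift i0 t).
    by have := ee' t; rewrite !ffunE.
  suff emod : (e i0 = e' i0 %[mod q])%N.
    apply/ffunP => t; case: (unliftP i0 t) => [j ->|->]; first exact: lift_eq.
    by apply: val_inj; rewrite /= (divn_eq (e i0) q) ediv emod -divn_eq.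
  apply: (eqmod_cancel p_pr r0 rs); apply/eqP.
  rewrite -(eq_prim_root_expr zetaP) !exprM -/r.
  have zeta0 : zeta != 0.
    apply: contraTneq zetaP => ->; apply/negP => /prim_expr_order/eqP.
    by rewrite expr0n gtn_eqF ?expn_gt0 ?prime_gt0// eq_sym oner_eq0.
  have R0 (f : {ffun 'I_d.+1 -> 'I_(p ^ n)}) (t : 'I_d.+1) :
      ((zeta ^+ f t) ^+ zp_res (x 0 t) n) != 0 by rewrite !expf_neq0.
  have charE (f : {ffun 'I_d.+1 -> 'I_(p ^ n)}) : char_of zeta f x =
      (zeta ^+ f i0) ^+ r *
      \prod_(t < d) (zeta ^+ f (lift i0 t)) ^+ zp_res (x 0 (lift i0 t)) n.
    by rewrite /char_of (bigD1_ord i0).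
  have := etrans eB (esym e'B); rewrite !charE !exprMn.
  under eq_bigr do rewrite lift_eq.
  move/mulIf => ->//.
  by rewrite expf_neq0//; apply/prodf_neq0 => t _; exact: R0.
rewrite -(card_in_imset psi_inj) (leq_trans (max_card _))//.
by rewrite card_prod card_ffun !card_ord mulnC -expnM [(n * d)%N]mulnC.
Qed.

(** * The sum over the support and its asymptotics *)

Lemma sum_Supp_char_of (p : nat) (p_pr : prime p) (d n : nat) (K : fieldType)
    (zeta : K) (F : Phi p_pr d) (G : (Gam p_pr d -> K) -> \bar rat) :
  (p ^ n).-primitive_root zeta ->
  (\sum_(w \in @Supp p p_pr d K n F) G w =
   \sum_(e : {ffun 'I_d -> 'I_(p ^ n)} |
           char_eval n (char_of (n := n) zeta e) F != 0%R)
     G (char_of (n := n) zeta e))%E.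
Proof.
move=> zetaP.
pose h (e : {ffun 'I_d -> 'I_(p ^ n)}) : Gam p_pr d -> K := char_of zeta e.
pose A : set {ffun 'I_d -> 'I_(p ^ n)} :=
  [set e | char_eval n (h e) F != 0]%classic.
have -> : Supp n F = (h @` A)%classic.
  apply/seteqP; split=> [w [wP wF]|w [e eA <-]].
    by have [e we] := dual_char_of zetaP wP; exists e; rewrite /A /h/= -?we.
  by split=> //; apply: char_of_dual.
rewrite fsbig_image; last by move=> e e' _ _ /(char_of_inj zetaP).
rewrite (fsbigE [seq e <- index_enum _ | char_eval n (h e) F != 0]).
- rewrite big_filter_cond; apply: eq_bigl => e.
  by rewrite andb_idr// => eF; rewrite inE.
- by rewrite filter_uniq// index_enum_uniq.
- by move=> e /=; rewrite mem_filter => /andP[].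
- by move=> e /= eA; rewrite mem_filter eA mem_index_enum.
Qed.

Theorem corollary6p6 (p l : nat) (p_pr : prime p) (l_pr : prime l)
    (p_neq_l : p <> l) (d : nat) (d_ge1 : (1 <= d)%N)
    (L : closedFieldType) (iota : {rmorphism padic_field l_pr -> L})
    (L_closure : alg_closure_of iota)
    (ord : L -> \bar rat) (ordP : is_ladic_ord iota ord)
    (F : Phi p_pr d) (F_neq0 : F != 0)
    (k : nat) (b : 'I_k -> int) (a : 'I_k -> Gam p_pr d)
    (a_inj : injective a) (F_def : F = \sum_(i < k) << b i *g a i >>) :
  let mu := \big[Order.min/+oo%E]_(i < k) ord (b i)%:~R in
  exists C : rat, \forall n \near \oo%classic,
    (`| \sum_(w \in @Supp p p_pr d L n F) ord (char_eval n w F)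
        - (p ^ (n * d))%:R%:E * mu |
     <= (C * (p ^ ((d - 1) * n))%:R)%:E)%E.
Proof.
move=> mu; case: ordP => ord_eqy ordM ordD _ ord_l.
(* From here on the rank is [d.+1], so the error exponent is d n. *)
case: d d_ge1 => // d _ in F F_neq0 a a_inj F_def *.
have root N : coprime N l -> (0 < N)%N -> exists z : L, N.-primitive_root z.
  move=> Nl _; apply: closed_prim_root; apply/eqP => /ord_eqy.
  by rewrite (ord_coprime l_pr ord_eqy ordM ordD ord_l Nl).
have [m m1 levels] := expn_levels p_pr l_pr p_neq_l.
have m0 : (0 < m)%N := ltnW m1.
have b0 : exists i, b i != 0.
  apply: contrapT => /forallNP h; case/eqP: F_neq0.
  rewrite F_def big1// => i _; have /negP/negPn/eqP -> := h i.
  exact: freegU0.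
have [C CP] := ord_sum_bounded l_pr ord_eqy ordM ordD ord_l p_pr p_neq_l root
  m0 levels b.
have [_ [M [muM _]]] := min_ord_attained l_pr ord_eqy ordM ordD ord_l b0.
rewrite -/mu in muM.
have /choice[A AP] (ij : 'I_k * 'I_k) : exists A : nat * nat, ij.1 != ij.2 ->
    forall n (zeta : L), (A.2 <= n)%N -> (p ^ n).-primitive_root zeta ->
    (#|[set e | (char_of (n := n) zeta e (a ij.1 - a ij.2) ^+ (p ^ m) == 1)%R]|
       <= A.1 * p ^ (d * n))%N.
  have [->|ij0] := eqVneq ij.1 ij.2; first by exists (0, 0)%N.
  have [|A1 [A2 AP]] := @card_char_of_torsion p p_pr d m (a ij.1 - a ij.2).
    by rewrite subr_eq0 (inj_eq a_inj).
  by exists (A1, A2) => _ n zeta; apply: AP.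
pose B := (\sum_(ij : 'I_k * 'I_k) (A ij).1)%N.
(* At most B p^(dn) characters are bad, and each deviates from mu = M by at most C + M. *)
exists (B * (C + M))%:R.
exists (\max_ij (A ij).2)%N => // n /= le_n.
have pn0 : (0 < p ^ n)%N by rewrite expn_gt0 prime_gt0.
have [zeta zetaP] := root _ (coprime_p_l l_pr p_pr p_neq_l n) pn0.
rewrite (sum_Supp_char_of F _ zetaP).
pose chi (e : {ffun 'I_d.+1 -> 'I_(p ^ n)}) : Gam p_pr d.+1 -> L :=
  char_of zeta e.
pose S e := char_eval n (chi e) F.
have SE e : S e = \sum_i (b i)%:~R * chi e (a i).
  exact: (char_eval_char_of zetaP _ a_inj F_def).
have chiX e x : chi e x ^+ (p ^ n) = 1 by exact: (char_ofX zetaP).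
have ord_chi e x : ord (chi e x) = 0%E.
  exact: (ord_unity ord_eqy ordM ord_l pn0).
(* The value 0 at zeros of F extends the sum to all characters. Such zeros are bad, since a good
   character has finite order M. *)
pose g e : rat := if S e == 0 then 0 else fine (ord (S e)).
pose bad : {set {ffun 'I_d.+1 -> 'I_(p ^ n)}} :=
  [set e | [exists ij : 'I_k * 'I_k, (ij.1 != ij.2) &&
    (chi e (a ij.1 - a ij.2) ^+ (p ^ m) == 1)]].
have S_fin e : S e != 0 -> ord (S e) = (g e)%:E.
  move=> S0; rewrite /g (negPf S0).
  by have [r ->] := ord_fin ord_eqy ordM ord_l S0.
have g_ge0 e : 0 <= g e.
  have [S0|S0] := eqVneq (S e) 0; first by rewrite /g S0 eqxx.
  rewrite -lee_fin -S_fin// SE; apply: (ord_le_sum ord_eqy ordD) => i _.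
  by rewrite ordM ord_chi adde0 (ord_int_ge0 ord_eqy ordM ordD ord_l).
have g_leC e : g e <= C%:R.
  have [S0|S0] := eqVneq (S e) 0; first by rewrite /g S0 eqxx ler0n.
  by rewrite -lee_fin -S_fin// SE; apply: CP (n) _ _ _ => //; rewrite -SE.
have g_good e : e \notin bad -> g e = M%:R.
  move=> e_good; have ordS : ord (S e) = M%:R%:E.
    rewrite SE -muM.
    apply: (ord_sum_separated l_pr ord_eqy ordM ordD ord_l p_pr p_neq_l root
      m0 levels b0 (n := n)) => //.
    move=> i j eij; apply/eqP; apply: contraNT e_good => ij.
    rewrite inE; apply/existsP; exists (i, j); rewrite ij /=.
    have ajE : chi e (a i) = chi e (a i - a j) * chi e (a j).
      by rewrite -(char_ofD zetaP) subrK.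
    move: eij; rewrite ajE exprMn -[RHS]mul1r => /mulIf -> //.
    rewrite expf_neq0//; apply/eqP => /ord_eqy.
    by rewrite ord_chi.
  by rewrite /g ordS; case: eqP => // S0; move/ord_eqy: S0; rewrite ordS.
have bad_card : (#|bad| <= B * p ^ (d * n))%N.
  pose bad_ij (ij : 'I_k * 'I_k) : {set {ffun 'I_d.+1 -> 'I_(p ^ n)}} :=
    [set e | chi e (a ij.1 - a ij.2) ^+ (p ^ m) == 1].
  have -> : bad = \bigcup_(ij | ij.1 != ij.2) bad_ij ij.
    apply/setP => e; rewrite inE; apply/existsP/bigcupP => -[ij].
      by case/andP => ? ?; exists ij; rewrite ?inE.
    by rewrite inE => ? ?; exists ij; apply/andP.
  apply: (@leq_trans (\sum_(ij | ij.1 != ij.2) #|bad_ij ij|)).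
    elim/big_rec2: _ => [|ij s T _ Ts]; first by rewrite cards0.
    by rewrite (leq_trans (leq_card_setU _ _))// leq_add2l.
  rewrite big_distrl /= [leqRHS](bigID (fun ij => ij.1 != ij.2)) /=.
  rewrite (leq_trans _ (leq_addr _ _))//; apply: leq_sum => ij ij0.
  apply: AP => //; apply: leq_trans le_n.
  exact: (@leq_bigmax _ (fun ij => (A ij).2) ij).
rewrite (eq_bigr (fun e => (g e)%:E)) => [|e S0]; last exact: S_fin.
rewrite sumEFin muM -EFinM -EFinB abse_EFin lee_fin.
rewrite (_ : \sum_(e | _) g e = \sum_e g e); last first.
  rewrite big_mkcond; apply: eq_bigr => e _; rewrite -/(S e) /g.
  by case: eqP.
(* The main term is M summed over all characters, so the difference can be taken termwise and
   vanishes outside [bad]. *)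
rewrite (_ : (p ^ (n * d.+1))%:R * M%:R =
    \sum_(e : {ffun 'I_d.+1 -> 'I_(p ^ n)}) M%:R); last first.
  by rewrite sumr_const card_ffun !card_ord expnM mulr_natl.
rewrite -sumrB (le_trans (ler_norm_sum _ _ _))//.
rewrite (bigID (mem bad)) /= [X in _ + X]big1 ?addr0; last first.
  by move=> e /g_good ->; rewrite subrr normr0.
have le1 e : `|g e - M%:R| <= (C + M)%:R.
  rewrite natrD (le_trans (ler_normB _ _))// lerD// ger0_norm ?ler0n//.
apply: (@le_trans _ _ (\sum_(e in bad) (C + M)%:R)).
  by apply: ler_sum => e _; exact: le1.
rewrite sumr_const -natrM -mulrnA ler_nat subn1 /= mulnC mulnAC.
exact: leq_mul.
Qed.
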